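(* Let $D=\mathcal{C}_1\cup_P\cdots\cup_P\mathcal{C}_n$ be a weighted oriented graph consisting of chordless cycles $\mathcal{C}_1,\ldots,\mathcal{C}_n$ that share a path $P$. Then: (i) $I_D$ is robust if and only if $I_D$ is strongly robust; (ii) $I_D$ is generalized robust if and only if $I_D$ is weakly robust.
   Context: A weighted oriented graph $D=(V(D),E(D),\mathbf{w})$ has a finite simple underlying graph (no loops, no multiple edges) with $V(D)=\{x_1,\dots,x_p\}$; each edge is an ordered pair $(x_i,x_j)$ oriented from its tail $x_i$ to its head $x_j$; $\mathbf{w}:V(D)\to\mathbb{N}=\{1,2,\dots\}$ is a weight function, $w_i=\mathbf{w}(x_i)$. Let $K$ be a field. The toric ideal $I_D\subset K[e:e\in E(D)]$ is the kernel of the $K$-algebra homomorphism $K[e:e\in E(D)]\to K[x_1,\dots,x_p]$ sending the variable $e=(x_i,x_j)$ to $x_ix_j^{w_j}$. Binomials are identified with their negatives. A binomial $\mathbf{e}^{\mathbf{u}}-\mathbf{e}^{\mathbf{v}}\in I_D$ is primitive if there is no other binomial $\mathbf{e}^{\mathbf{u}'}-\mathbf{e}^{\mathbf{v}'}\in I_D$ (nonzero) with $\mathbf{e}^{\mathbf{u}'}\mid\mathbf{e}^{\mathbf{u}}$ and $\mathbf{e}^{\mathbf{v}'}\mid\mathbf{e}^{\mathbf{v}}$. $Gr_D$ (Graver basis) is the set of primitive binomials of $I_D$; $\mathcal{U}_D$ (universal Gröbner basis) is the union of all reduced Gröbner bases of $I_D$ over all term orders; $\mathcal{M}_D$ (universal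 Markov basis) is the union of all minimal binomial generating sets of $I_D$. The ideal $I_D$ is strongly robust if $Gr_D$ is a minimal generating set of $I_D$; robust if $\mathcal{U}_D$ is a minimal generating set of $I_D$; generalized robust if $\mathcal{U}_D=\mathcal{M}_D$; weakly robust if $Gr_D=\mathcal{M}_D$. A chord of a cycle $\mathcal{C}$ in $D$ is an edge of $D$ not in $E(\mathcal{C})$ whose two end vertices lie in $V(\mathcal{C})$; a cycle is chordless if it has no chord. Cycles refer to cycles of the underlying undirected graph, with inherited orientation and weights. The notation $D=\mathcal{C}_1\cup_P\cdots\cup_P\mathcal{C}_n$ means that $D$ is the union of the cycles $\mathcal{C}_1,\dots,\mathcal{C}_n$, that $P$ is a path of length (number of edges) at least $1$ contained in every $\mathcal{C}_i$, with $E(\mathcal{C}_i)\ne E(P)$, and that any two distinct cycles intersect exactly in $P$ (both in vertices and edges). *)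

(* Defs.v *)
From mathcomp Require Import all_boot all_order all_algebra.
From mathcomp.multinomials Require Import mpoly.

Set Implicit Arguments.
Unset Strict Implicit.
Unset Printing Implicit Defensive.

Import GRing.Theory.
Local Open Scope ring_scope.

(* An arc (i, j) is the edge with tail i and head j. *)
Record wograph := WOGraph {
  nvert : nat;
  arcs : {set 'I_nvert * 'I_nvert};
  weight : 'I_nvert -> nat;
  arcs_loopless : forall i, (i, i) \notin arcs;
  arcs_simple : forall i j, (i, j) \in arcs -> (j, i) \notin arcs;
  weight_gt0 : forall i, (0 < weight i)%N
}.

Notation vertex D := 'I_(nvert D).

Definition adj (D : wograph) : rel (vertex D) :=
  fun x y => ((x, y) \in arcs D) || ((y, x) \in arcs D).

(* The arcs of D that underlie one of the (undirected) steps in s. *)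
Definition step_arcs (D : wograph) (s : seq (vertex D * vertex D)) :
    {set vertex D * vertex D} :=
  [set a in arcs D | (a \in s) || ((a.2, a.1) \in s)].

(* Paths and cycles of the underlying undirected graph are given by the
   sequence of their vertices. *)
Definition is_path (D : wograph) (s : seq (vertex D)) : bool :=
  sorted (@adj D) s && uniq s.

Definition path_arcs (D : wograph) (s : seq (vertex D)) :=
  step_arcs (zip s (behead s)).

Definition is_cycle (D : wograph) (c : seq (vertex D)) : bool :=
  [&& (2 < size c)%N, cycle (@adj D) c & uniq c].

Definition cycle_arcs (D : wograph) (c : seq (vertex D)) :=
  step_arcs (zip c (rot 1 c)).

Definition is_chord (D : wograph) (c : seq (vertex D))
    (a : vertex D * vertex D) : bool :=
  [&& a \in arcs D, a \notin cycle_arcs c, a.1 \in c & a.2 \in c].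

Definition chordless (D : wograph) (c : seq (vertex D)) : Prop :=
  forall a, ~~ is_chord c a.

(* D = C_1 \cup_P ... \cup_P C_n. *)
Definition cycles_sharing_path (D : wograph) (n : nat)
    (C : 'I_n -> seq (vertex D)) (P : seq (vertex D)) : Prop :=
  [/\ [/\ forall i, is_cycle (C i), is_path P & (1 <= (size P).-1)%N],
      forall i, [/\ {subset P <= C i},
                    path_arcs P \subset cycle_arcs (C i)
                  & cycle_arcs (C i) != path_arcs P],
      forall i j, i != j ->
        (forall x, (x \in C i) && (x \in C j) = (x \in P)) /\
        cycle_arcs (C i) :&: cycle_arcs (C j) = path_arcs P,
      forall x : vertex D, exists i, x \in C i
    & arcs D = \bigcup_(i < n) cycle_arcs (C i)].

Section Polynomials.
Variables (K : fieldType) (m : nat).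
Implicit Types (f g h : {mpoly K[m]}) (u v w : 'X_{1..m}).
Implicit Types (S T I : {mpoly K[m]} -> Prop) (le : rel 'X_{1..m}).

Definition is_binomial f : Prop :=
  exists u v, u != v /\ f = 'X_[u] - 'X_[v].

(* Binomials are identified with their negatives: sets of polynomials are
   compared up to sign. *)
Definition sub_pm S T : Prop := forall f, S f -> T f \/ T (- f).

Definition eq_pm S T : Prop := sub_pm S T /\ sub_pm T S.

Definition ideal_gen S f : Prop :=
  exists s : seq ({mpoly K[m]} * {mpoly K[m]}),
    (forall x, x \in s -> S x.2) /\ f = \sum_(x <- s) x.1 * x.2.

Definition generates S I : Prop := forall f, ideal_gen S f <-> I f.

(* S generates I, and no subset of S that is proper up to sign does; thus a
   set is not penalized for containing both f and - f. *)
Definition minimal_generating_set S I : Prop :=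
  generates S I /\
  forall T, (forall f, T f -> S f) -> generates T I -> sub_pm S T.

Definition term_order le : Prop :=
  [/\ [/\ total le, antisymmetric le & transitive le],
      forall u, le 0%MM u
    & forall u v w, le u v -> le (u + w)%MM (v + w)%MM].

Definition is_lead le f u : Prop :=
  u \in msupp f /\ forall v, v \in msupp f -> le v u.

Definition lead_monomials le S h : Prop :=
  exists f u, [/\ S f, is_lead le f u & h = 'X_[u]].

Definition initial_ideal le I := ideal_gen (lead_monomials le I).

Definition groebner_basis le (G : seq {mpoly K[m]}) I : Prop :=
  (forall g, g \in G -> I g) /\
  generates (lead_monomials le (fun g => g \in G)) (initial_ideal le I).

Definition reduced_groebner_basis le (G : seq {mpoly K[m]}) I : Prop :=
  [/\ groebner_basis le G I,
      forall g, g \in G -> exists2 u, is_lead le g u & g@_u = 1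
    & forall g h u v, g \in G -> h \in G -> g != h ->
        is_lead le g u -> v \in msupp h -> ~~ (u <= v)%MM].

Definition primitive_pair I u v : Prop :=
  [/\ u != v, I ('X_[u] - 'X_[v])
    & forall u' v', u' != v' -> I ('X_[u'] - 'X_[v']) ->
        (u' <= u)%MM -> (v' <= v)%MM -> (u', v') = (u, v)].

Definition graver_basis I f : Prop :=
  exists u v, primitive_pair I u v /\ f = 'X_[u] - 'X_[v].

Definition universal_groebner_basis I f : Prop :=
  exists le G, [/\ term_order le, reduced_groebner_basis le G I & f \in G].

Definition universal_markov_basis I f : Prop :=
  exists B : {mpoly K[m]} -> Prop,
    [/\ forall g, B g -> is_binomial g, minimal_generating_set B I & B f].

End Polynomials.

(* The variable of index k stands for the k-th arc, enum_val k. *)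
Definition toric_ideal (K : fieldType) (D : wograph)
    (f : {mpoly K[#|arcs D|]}) : Prop :=
  f \mPo [tuple 'X_(enum_val k).1
                * 'X_(enum_val k).2 ^+ weight (enum_val k).2 | k < #|arcs D|]
  = 0 :> {mpoly K[nvert D]}.

Definition strongly_robust (K : fieldType) (D : wograph) : Prop :=
  minimal_generating_set (graver_basis (@toric_ideal K D)) (@toric_ideal K D).

Definition robust (K : fieldType) (D : wograph) : Prop :=
  minimal_generating_set (universal_groebner_basis (@toric_ideal K D))
                         (@toric_ideal K D).

Definition generalized_robust (K : fieldType) (D : wograph) : Prop :=
  eq_pm (universal_groebner_basis (@toric_ideal K D))
        (universal_markov_basis (@toric_ideal K D)).

Definition weakly_robust (K : fieldType) (D : wograph) : Prop :=
  eq_pm (graver_basis (@toric_ideal K D))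
        (universal_markov_basis (@toric_ideal K D)).

(* Main.v *)
(* The ideal I_D satisfies U_D = Gr_D up to sign; since the Markov basis does
   not depend on either, both equivalences follow.  The inclusion of U_D in Gr_D
   holds for every toric ideal.  Conversely, let e^u - e^v be primitive.  Since
   the cycles are chordless, every edge but the first one, e0, of the shared
   path P has an end vertex that lies on only one other edge.  The degree
   equation at such a vertex forces a monomial e^y of the fiber of e^u to
   satisfy y <= max(u, v) outside e0.  If this also holds at e0, then y is u or
   v by primitivity; otherwise y e0 > max(u e0, v e0), and a suitable weight
   vector supported by e0 and one more edge takes equal values at u and v and a
   larger one at y.  Hence u and v are the two smallest monomials of their fiber
   for a term order refining this weight, and e^u - e^v belongs, up to sign, to
   the corresponding reduced Groebner basis. *)

Require Import Defs.
From mathcomp Require Import all_boot all_order all_algebra.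
From mathcomp.multinomials Require Import mpoly.
From mathcomp Require Import zify.
From Stdlib Require Import ClassicalEpsilon.

Set Implicit Arguments.
Unset Strict Implicit.
Unset Printing Implicit Defensive.

Import Order.TTheory GRing.Theory.
Local Open Scope ring_scope.

(** * Dickson's lemma and term orders *)

Lemma seq_least (X : eqType) (r : rel X) (s : seq X) :
  total r -> transitive r -> s != [::] ->
  exists2 v, v \in s & forall w, w \in s -> r v w.
Proof.
move=> rtot rtr; have rr x : r x x by case/orP: (rtot x x).
elim: s => // x [|y s] IH _.
  by exists x; rewrite ?inE // => w; rewrite inE => /eqP->.
have [//|v vs vP] := IH; have /orP[xv|vx] := rtot x v.
  exists x => [|w]; first by rewrite inE eqxx.
  by rewrite inE => /orP[/eqP->//|/vP]; apply: rtr.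
exists v => [|w]; first by rewrite inE vs orbT.
by rewrite inE => /orP[/eqP->|/vP].
Qed.

Section MonomialSets.
Variable m : nat.
Implicit Types (S : 'X_{1..m} -> Prop) (u v w : 'X_{1..m}).

(** Induction on the number [k] of compared coordinates. The list [s] for [k] coordinates also
    serves every [u] whose next coordinate is at least the maximum of that coordinate over [s].
    Smaller values are finitely many, and each slice with a fixed value is treated by induction. *)
Lemma dickson_prefix (k : nat) S :
  exists s : seq 'X_{1..m}, (forall u, u \in s -> S u) /\
    forall u, S u -> exists2 v, v \in s & forall i : 'I_m, (i < k)%N -> (v i <= u i)%N.
Proof.
elim: k S => [|k IH] S.
  have [[u Su]|nS] := classic (exists u, S u).
    by exists [:: u]; split=> [v|v _]; [rewrite inE => /eqP-> | exists u; rewrite ?inE].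
  by exists [::]; split=> // u Su; case: nS; exists u.
have [s [sS sP]] := IH S.
have [lekm|ltmk] := ltnP k m; last first.
  exists s; split=> // u /sP[v vs vu]; exists v => // i _.
  by apply: vu; apply: leq_trans (ltn_ord i) ltmk.
pose i0 := Ordinal lekm.
have below M : exists s' : seq 'X_{1..m}, (forall u, u \in s' -> S u) /\
    forall u, S u -> (u i0 < M)%N ->
    exists2 v, v \in s' & forall i : 'I_m, (i < k.+1)%N -> (v i <= u i)%N.
  elim: M => [|M [s1 [s1S s1P]]]; first by exists [::].
  have [s2 [s2S s2P]] := IH (fun u => S u /\ u i0 = M).
  exists (s1 ++ s2); split=> [u|u Su].
    by rewrite mem_cat => /orP[/s1S|/s2S[]].
  rewrite ltnS leq_eqVlt => /orP[/eqP uM|uM].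
    have [v vs vu] := s2P u (conj Su uM).
    exists v => [|i]; first by rewrite mem_cat vs orbT.
    rewrite ltnS leq_eqVlt => /orP[/eqP ik|/vu//].
    have -> : i = i0 by apply: val_inj.
    by rewrite uM; have [_ ->] := s2S v vs.
  by have [v vs vu] := s1P u Su uM; exists v; rewrite // mem_cat vs.
have [s' [s'S s'P]] := below (\max_(v <- s) v i0)%N.
exists (s ++ s'); split=> [u|u Su].
  by rewrite mem_cat => /orP[/sS|/s'S].
have [ltu|leu] := ltnP (u i0) (\max_(v <- s) v i0)%N.
  by have [v vs vu] := s'P u Su ltu; exists v; rewrite // mem_cat vs orbT.
have [v vs vu] := sP u Su; exists v => [|i]; first by rewrite mem_cat vs.
rewrite ltnS leq_eqVlt => /orP[/eqP ik|/vu//].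
have -> : i = i0 by apply: val_inj.
by apply: leq_trans leu; apply: leq_bigmax_seq.
Qed.

Lemma dickson S :
  exists s : seq 'X_{1..m}, (forall u, u \in s -> S u) /\
    forall u, S u -> exists2 v, v \in s & (v <= u)%MM.
Proof.
have [s [sS sP]] := dickson_prefix m S; exists s; split=> // u /sP[v vs vu].
by exists v => //; apply/mnm_lepP => i; apply: vu.
Qed.

Lemma exists_minimal_divisor S u : S u ->
  exists v, [/\ S v, (v <= u)%MM & forall w, S w -> (w <= v)%MM -> w = v].
Proof.
have [d] := ubnP (mdeg u); elim: d u => // d IH u du Su.
have [[w [Sw wu nwu]]|nw] :=
    classic (exists w, [/\ S w, (w <= u)%MM & w <> u]).
  have [|v [Sv vw vP]] := IH w _ Sw.
    have := mdegD (u - w)%MM w; rewrite submK // => eqd.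
    have : mdeg (u - w)%MM != 0%N.
      by rewrite mdeg_eq0; apply/eqP => e; apply: nwu; rewrite -(submK wu) e add0m.
    lia.
  by exists v; split=> //; apply: lepm_trans vw wu.
exists u; split=> // [|w Sw wu]; first exact: lepm_refl.
by have [//|nwu] := classic (w = u); case: nw; exists w.
Qed.

End MonomialSets.

Section TermOrders.
Variables (m : nat) (le : rel 'X_{1..m}).
Hypothesis le_term : term_order le.
Implicit Types (u v w : 'X_{1..m}).

Lemma term_order_refl u : le u u.
Proof. by have [[letot _ _] _ _] := le_term; case/orP: (letot u u). Qed.

Lemma term_order_anti u v : le u v -> le v u -> u = v.
Proof. by have [[_ lean _] _ _] := le_term => uv vu; apply: lean; rewrite uv. Qed.

Lemma term_order_cancel u v w : le (u + w)%MM (v + w)%MM -> le u v.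
Proof.
have [[letot _ _] _ leD] := le_term => leuv.
have /orP[//|levu] := letot u v.
by have /addIm-> := term_order_anti leuv (leD _ _ w levu); apply: term_order_refl.
Qed.

Lemma lem_term_order u v : (u <= v)%MM -> le u v.
Proof.
have [_ le0 leD] := le_term => /submK <-.
by rewrite -{1}[u]add0m; apply: leD.
Qed.

(** A term order extends divisibility, so the least of the finitely many divisors given by Dickson's
    lemma is least in [S]. *)
Lemma term_order_min (S : 'X_{1..m} -> Prop) u : S u ->
  exists v, S v /\ forall w, S w -> le v w.
Proof.
have [[letot _ letr] _ _] := le_term => Su.
have [s [sS sP]] := dickson S.
have [|v vs vP] := seq_least letot letr (s := s).
  by case: s sP {sS} => // /(_ u Su)[].
exists v; split=> [|w /sP[x xs xw]]; first exact: sS.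
by apply: letr (vP x xs) (lem_term_order xw).
Qed.

End TermOrders.

(** Natural weights keep the monomial 1 least; ties are broken by the monomial order [<=%O]. *)
Definition weighted_order (m : nat) (W : 'I_m -> nat) : rel 'X_{1..m} :=
  fun u v => let d u := (\sum_k W k * u k)%N in
    (d u < d v)%N || ((d u == d v) && (u <= v)%O).

Lemma term_order_weighted (m : nat) (W : 'I_m -> nat) :
  term_order (weighted_order W).
Proof.
rewrite /weighted_order; pose d (u : 'X_{1..m}) := (\sum_k W k * u k)%N.
have dD u v : d (u + v)%MM = (d u + d v)%N.
  by rewrite /d -big_split; apply: eq_bigr => k _; rewrite mnmDE mulnDr.
split; first split.
- move=> u v /=; rewrite -!/(d _); case: ltngtP => //= _; exact: le_total.
- by move=> u v /=; rewrite -!/(d _); case: ltngtP => //= _; apply: le_anti.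
- move=> v u w /=; rewrite -!/(d _) => /orP[duv|/andP[/eqP-> uv]].
    by case/orP=> [dvw|/andP[/eqP<- _]]; rewrite ?duv ?(ltn_trans duv).
  by case/orP=> [->//|/andP[-> vw]]; rewrite (le_trans uv vw) orbT.
- move=> u /=; have -> : (\sum_k W k * 0%MM k = 0)%N.
    by rewrite big1 // => k _; rewrite mnm0E muln0.
  by rewrite le0m andbT orbC -leq_eqVlt.
move=> u v w /=; rewrite -!/(d _) !dD.
by rewrite ltn_add2r eqn_add2r lemc_add2l.
Qed.

(** * Reduced Groebner bases of toric ideals *)

Section IdealGen.
Variables (K : fieldType) (m : nat).
Implicit Types (f g h : {mpoly K[m]}) (u v w : 'X_{1..m}).
Implicit Types (S T I : {mpoly K[m]} -> Prop) (le : rel 'X_{1..m}).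

Lemma ideal_gen_sub S T :
  (forall f, S f -> exists q g, T g /\ f = q * g) ->
  forall f, ideal_gen S f -> ideal_gen T f.
Proof.
move=> ST f [s [sS ->]]; elim: s sS => [|x s IH] sS.
  by exists [::]; rewrite !big_nil.
have [|t [tT tE]] := IH; first by move=> y ys; apply: sS; rewrite inE ys orbT.
have [q [g [Tg xq]]] := ST x.2 (sS x (mem_head _ _)).
rewrite big_cons xq tE; exists ((x.1 * q, g) :: t); split=> [y|].
  by rewrite inE => /orP[/eqP->|/tT].
by rewrite big_cons mulrA.
Qed.

Lemma ideal_gen_pm S T : sub_pm S T -> forall f, ideal_gen S f -> ideal_gen T f.
Proof.
move=> ST; apply: ideal_gen_sub => f /ST[Tf|Tf].
  by exists 1, f; rewrite mul1r.
by exists (- 1), (- f); rewrite mulrNN mul1r.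
Qed.

Lemma ideal_gen_mem S f : S f -> ideal_gen S f.
Proof.
move=> Sf; exists [:: (1, f)]; rewrite big_seq1 mul1r; split=> // x.
by rewrite inE => /eqP->.
Qed.

Lemma minimal_generating_set_pm S T I : eq_pm S T ->
  minimal_generating_set S I -> minimal_generating_set T I.
Proof.
move=> [ST TS] [genS minS]; split=> [f|T' T'T genT'].
  rewrite -genS; split; exact: ideal_gen_pm.
(* A generating subset [T'] of [T] is moved back into [S] by keeping the elements that belong to
   [T'] up to sign. *)
have S'gen : generates (fun f => S f /\ (T' f \/ T' (- f))) I.
  move=> f; rewrite -genT'; split; apply: ideal_gen_pm => g; first by case.
  move=> T'g; have [Sg|Sg] := TS g (T'T g T'g); [left|right]; split=> //.
    by left.
  by right; rewrite opprK.
have S'S f : S f /\ (T' f \/ T' (- f)) -> S f by case.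
move=> f Tf; have [/(minS _ S'S S'gen)|/(minS _ S'S S'gen)] := TS f Tf.
  by rewrite opprK => -[[]|[_ []]]; auto.
by rewrite opprK => -[[_ []]|[]]; rewrite ?opprK; intuition.
Qed.

Lemma lead_unique le f u v : term_order le ->
  is_lead le f u -> is_lead le f v -> u = v.
Proof. by move=> leT [fu uP] [fv vP]; apply: (term_order_anti leT); auto. Qed.

Lemma lead_exists le f : term_order le -> f != 0 -> exists u, is_lead le f u.
Proof.
case=> [[letot _ letr] _ _]; rewrite -msupp_eq0 => f0.
have [||u fu uP] := @seq_least _ (fun u v => le v u) (msupp f) _ _ f0.
- by move=> u v; apply: letot.
- by move=> v u w vu wv; apply: letr wv vu.
by exists u.
Qed.

Lemma ideal_gen_lead_monomials le S f w :
  ideal_gen (lead_monomials le S) f -> w \in msupp f ->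
  exists g u, [/\ S g, is_lead le g u & (u <= w)%MM].
Proof.
move=> [s [sS ->]] /msupp_sum_le /flatten_mapP[x]; rewrite filter_predT => xs.
have [g [u [Sg gu ->]]] := sS x xs.
rewrite (perm_mem (msuppMX _ _)) => /mapP[v _ ->].
by exists g, u; split=> //; apply: lem_addr.
Qed.

Lemma msupp_binomial u v : u != v ->
  msupp ('X_[K, u] - 'X_[v]) =i [:: u; v].
Proof.
move=> uv w; rewrite mcoeff_msupp mcoeffB !mcoeffX !inE ![w == _]eq_sym.
have [<-|uw] := eqVneq u w.
  by rewrite (eq_sym v) (negbTE uv) subr0 oner_eq0.
by case: (v == w); rewrite ?subrr ?sub0r ?oppr_eq0 ?oner_eq0 ?eqxx.
Qed.

Lemma is_lead_binomial le u v : term_order le -> u != v -> le v u ->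
  is_lead le ('X_[K, u] - 'X_[v]) u.
Proof.
move=> leT uv levu; split=> [|w]; rewrite msupp_binomial // ?mem_head //.
by rewrite !inE => /orP[/eqP->|/eqP->]; rewrite ?term_order_refl.
Qed.

End IdealGen.

Section Toric.
Variables (K : fieldType) (m p : nat) (T : 'I_m -> 'X_{1..p}).
Implicit Types (f g h : {mpoly K[m]}) (u v w : 'X_{1..m}).

(** Arbitrary exponent vectors [T] are allowed; the graph enters only later, through
    [arc_exponent]. *)
Definition toric f : Prop := f \mPo [tuple 'X_[T k] | k < m] = 0 :> {mpoly K[p]}.

(** The fiber of a monomial is its level set under this map. *)
Definition mexp u : 'X_{1..p} := (\sum_(k < m) T k *+ u k)%MM.

Lemma mexpE u x : mexp u x = (\sum_k T k x * u k)%N.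
Proof. by rewrite mnm_sumE; apply: eq_bigr => k _; rewrite mulmnE. Qed.

Lemma mdeg_mexp u : mdeg (mexp u) = (\sum_k mdeg (T k) * u k)%N.
Proof. by rewrite mdeg_sum; apply: eq_bigr => k _; rewrite mdegMn. Qed.

Lemma mexpD u v : mexp (u + v)%MM = (mexp u + mexp v)%MM.
Proof.
apply/mnmP => x; rewrite mnmDE !mexpE -big_split.
by apply: eq_bigr => k _; rewrite mnmDE mulnDr.
Qed.

Lemma mexp_comp u : 'X_[u] \mPo [tuple 'X_[T k] | k < m] = 'X_[K, mexp u].
Proof.
rewrite comp_mpolyX -mprodXnE; apply: eq_bigr => k _.
by rewrite tnth_mktuple.
Qed.

Lemma toricB f g : toric f -> toric g -> toric (f - g).
Proof. by rewrite /toric comp_mpolyB => -> ->; rewrite subrr. Qed.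

Lemma toric_binomial u v : toric ('X_[u] - 'X_[v]) <-> mexp u = mexp v.
Proof.
rewrite /toric comp_mpolyB !mexp_comp; split=> [/eqP|->]; last exact: subrr.
rewrite subr_eq0 => /eqP e; apply/eqP; have := mcoeffX K (mexp u) (mexp v).
by rewrite e mcoeffX eqxx; case: eqP => // _ /eqP; rewrite oner_eq0.
Qed.

(** The coefficients of [f] over each fiber sum to zero, so no monomial of [f] is alone in its
    fiber. *)
Lemma toric_supp f u : toric f -> u \in msupp f ->
  exists v, [/\ v \in msupp f, v != u & mexp v = mexp u].
Proof.
rewrite /toric comp_mpolyEX => f0 fu.
have [/hasP[v fv /andP[vu /eqP]]|/hasPn nf] :=
  boolP (has (fun v => (v != u) && (mexp v == mexp u)) (msupp f)).
  by exists v.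
have : f@_u = 0; last by move/eqP; rewrite mcoeff_eq0 fu.
have /(congr1 (mcoeff (mexp u))) := f0.
rewrite raddf_sum mcoeff0 (bigD1_seq u) ?msupp_uniq //= mcoeffZ mexp_comp.
rewrite mcoeffX eqxx mulr1.
rewrite big_seq_cond big1 ?addr0 // => v /andP[fv vu].
by have := nf v fv; rewrite vu /= mcoeffZ mexp_comp mcoeffX => /negbTE->; rewrite mulr0.
Qed.

Section Groebner.
Variable le : rel 'X_{1..m}.
Hypothesis le_term : term_order le.

(** For a toric ideal these are exactly the monomials outside the initial ideal. *)
Definition standard u : Prop := forall v, mexp v = mexp u -> le u v.

Lemma lead_not_standard f u : toric f -> is_lead le f u -> ~ standard u.
Proof.
move=> /toric_supp fT [/fT[v [fv vu evu]] uP] su.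
by rewrite (term_order_anti le_term (uP v fv) (su v evu)) eqxx in vu.
Qed.

Lemma standard_divisor u w : standard w -> (u <= w)%MM -> standard u.
Proof.
move=> sw uw v evu; apply: (term_order_cancel le_term (w := w - u)%MM).
rewrite [X in le X](addmC u) submK //; apply: sw.
by rewrite -{2}(submK uw) !mexpD evu addmC.
Qed.

Lemma standard_unique u v : standard u -> standard v -> mexp u = mexp v -> u = v.
Proof. by move=> su sv e; apply: (term_order_anti le_term); [apply: su | apply: sv]. Qed.

Lemma standard_exists u : exists v, standard v /\ mexp v = mexp u.
Proof.
have [v [vu vP]] :=
  term_order_min (S := fun v => mexp v = mexp u) le_term (erefl (mexp u)).
by exists v; split=> // w ew; apply: vP; rewrite ew.
Qed.

Lemma not_standard_lead u : ~ standard u ->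
  lead_monomials le toric 'X_[u].
Proof.
move=> nsu; have [v [sv ev]] := standard_exists u.
have uv : u != v by apply/eqP => e; rewrite e in nsu.
exists ('X_[u] - 'X_[v]), u; split=> //; first exact/toric_binomial.
by apply: is_lead_binomial => //; apply: sv.
Qed.

Lemma groebner_basis_lead G u : groebner_basis le G toric -> ~ standard u ->
  exists h v, [/\ h \in G, is_lead le h v & (v <= u)%MM].
Proof.
move=> [_ Ggen] /not_standard_lead lu.
have /Ggen Gu : initial_ideal le toric 'X_[u] by apply: ideal_gen_mem.
by apply: ideal_gen_lead_monomials Gu _; rewrite msuppX mem_head.
Qed.

(** An element of [G] is its lead [u] minus the standard monomial [v] of the fiber. If [u'] and [v']
    divide [u] and [v] and share a fiber, then [v'] is standard, so [u'] is not and is divisible by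
    a lead of [G]. By reducedness this lead is [u]; hence [u' = u], and [v' = v] follows. *)
Lemma reduced_groebner_basis_graver G g :
  reduced_groebner_basis le G toric -> g \in G -> graver_basis toric g.
Proof.
move=> [GG Gmonic Gred] gG; have [GI _] := GG.
have [u gu gu1] := Gmonic g gG.
have only_g h a w : h \in G -> is_lead le h a -> w \in msupp g -> (a <= w)%MM -> a = u.
  move=> hG ha gw aw; apply: (lead_unique le_term (f := g)) => //.
  have [<-//|hg] := eqVneq h g.
  by have := Gred _ _ _ _ hG gG hg ha gw; rewrite aw.
have nsu := lead_not_standard (GI g gG) gu.
have [v [sv evu]] := standard_exists u.
have uv : u != v by apply/eqP => e; rewrite e in nsu.
have uvI : toric ('X_[u] - 'X_[v]) by apply/toric_binomial.
have gE : g = 'X_[u] - 'X_[v].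
  (* The lead of a nonzero difference is not standard, hence can only be [u]; but the coefficient of
     [u] cancels because [g] is monic. *)
  apply/eqP; rewrite -subr_eq0; apply/negPn/negP => r0.
  set r := g - _ in r0.
  have rI : toric r by apply: toricB (GI g gG) uvI.
  have [w rw] := lead_exists le_term r0.
  have nsw := lead_not_standard rI rw.
  have [h [a [hG ha aw]]] := groebner_basis_lead GG nsw.
  have wu : w = u.
    case: rw => /msuppB_le; rewrite mem_cat => /orP[gw _|vw _].
      have au := only_g h a w hG ha gw aw; rewrite au in aw.
      by apply: (term_order_anti le_term); [case: gu => _; apply | apply: lem_term_order].
    move: vw; rewrite msupp_binomial // !inE => /orP[/eqP//|/eqP wv].
    by rewrite wv in nsw.
  case: rw => + _; rewrite wu mcoeff_msupp !mcoeffB gu1 !mcoeffX eqxx.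
  by rewrite (eq_sym v) (negbTE uv) subr0 subrr eqxx.
exists u, v; split=> //; split=> // u' v' u'v' /toric_binomial e u'u v'v.
have sv' := standard_divisor sv v'v.
have nsu' : ~ standard u'.
  by move=> su'; case/eqP: u'v'; apply: standard_unique.
have [h [a [hG ha au']]] := groebner_basis_lead GG nsu'.
have au := only_g h a u hG ha (proj1 gu) (lepm_trans au' u'u).
have u'E : u' = u.
  by apply: (term_order_anti le_term); apply: lem_term_order; rewrite // -au.
congr pair => //; apply: standard_unique => //; by rewrite -e u'E.
Qed.

(** The basis consists of the minimal nonstandard monomials, finite in number by Dickson's lemma,
    each minus its normal form. *)
Lemma exists_reduced_groebner_basis : exists G,
  reduced_groebner_basis le G toric /\
  forall u v, ~ standard u -> (forall w, ~ standard w -> (w <= u)%MM -> w = u) ->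
    standard v -> mexp v = mexp u -> 'X_[u] - 'X_[v] \in G.
Proof.
pose mingen u := ~ standard u /\ forall w, ~ standard w -> (w <= u)%MM -> w = u.
have [s [smin sP]] := dickson mingen.
pose fiber_min u v := standard v /\ mexp v = mexp u.
(* The normal form of [u] is the least monomial of its fiber. *)
pose nf u := epsilon (inhabits 0%MM) (fiber_min u).
have nfP u : fiber_min u (nf u).
  exact: (epsilon_spec (inhabits 0%MM) (fiber_min u) (standard_exists u)).
have nfN u : u \in s -> u != nf u.
  by move=> /smin[nsu _]; apply/eqP => e; case: nsu; rewrite e; exact: (nfP u).1.
have sG u : ~ standard u -> exists2 v, v \in s & (v <= u)%MM.
  move=> nsu; have [v [nsv vu vP]] :=
    exists_minimal_divisor (S := fun w => ~ standard w) nsu.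
  have [//|w ws wv] := sP v; exists w => //; exact: lepm_trans wv vu.
have lead_nf u : u \in s -> is_lead le ('X_[K, u] - 'X_[nf u]) u.
  move=> us; apply: is_lead_binomial => //; first exact: nfN.
  by apply: (nfP u).1; rewrite (nfP u).2.
exists [seq 'X_[u] - 'X_[nf u] | u <- s]; split; last first.
  move=> u v nsu uP sv evu; have [//|w ws wu] := sP u.
  have wE : w = u by apply: uP => //; case: (smin w ws).
  have -> : v = nf u by apply: standard_unique; rewrite ?(nfP u).2 //; exact: (nfP u).1.
  by rewrite -wE; apply: map_f.
split; first split.
- by move=> g /mapP[u us ->]; apply/toric_binomial; rewrite (nfP u).2.
- move=> f; split; apply: ideal_gen_sub => h [g [u [gT gu ->]]].
    exists 1, 'X_[u]; rewrite mul1r; split=> //; exists g, u; split=> //.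
    by case/mapP: gT => w ws ->; apply/toric_binomial; rewrite (nfP w).2.
  have [v vs vu] := sG u (lead_not_standard gT gu).
  exists 'X_[(u - v)%MM], 'X_[v]; rewrite -mpolyXD submK //; split=> //.
  by exists ('X_[v] - 'X_[nf v]), v; split=> //; [apply: map_f | apply: lead_nf].
- move=> g /mapP[u us ->]; exists u; first exact: lead_nf.
  by rewrite mcoeffB !mcoeffX eqxx (eq_sym (nf u)) (negbTE (nfN u us)) subr0.
move=> g h u v /mapP[a as_ ->] /mapP[b bs ->] gh ga hv.
have -> : u = a by apply: lead_unique ga (lead_nf a as_).
apply/negP => av; move: hv; rewrite msupp_binomial ?nfN // !inE.
(* If [v] is the normal form of [b], its divisor [a] would be standard; if [v] is [b], minimality
   gives [a = b]. *)
case/orP=> /eqP vE; last first.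
  by case: (smin a as_) => -[]; apply: standard_divisor av; rewrite vE; exact: (nfP b).1.
case/eqP: gh; have -> // : a = b.
by apply: (proj2 (smin b bs)); [case: (smin a as_) | rewrite -vE].
Qed.

(* If u and v are the two smallest monomials of their fiber, then v is standard,
   and so is every proper divisor of u, since u and v are coprime. *)
Lemma universal_groebner_two_least u v :
  u != v -> mexp u = mexp v -> (forall k, (u k == 0%N) || (v k == 0%N)) -> le v u ->
  (forall y, mexp y = mexp u -> y != u -> y != v -> le u y) ->
  universal_groebner_basis toric ('X_[u] - 'X_[v]).
Proof.
move=> uv euv disj levu least.
have [G [GG GP]] := exists_reduced_groebner_basis.
exists le, G; split=> //; apply: GP => //.
- by move=> su; case/eqP: uv; apply: (term_order_anti le_term) => //; apply: su.
- move=> w nsw wu; apply/eqP/negPn/negP => wNu; case: nsw => y eyw.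
  have ez : mexp (y + (u - w))%MM = mexp u by rewrite mexpD eyw -mexpD addmC submK.
  apply: (term_order_cancel le_term (w := u - w)%MM).
  rewrite [X in le X](addmC w) submK //.
  have [->|zu] := eqVneq (y + (u - w))%MM u; first exact: term_order_refl.
  (* If the translate by [u - w] were [v], then [u - w] would divide both [u] and [v], which are
     coprime, so [w = u]. *)
  apply: least => //; apply/eqP => zv; case/eqP: wNu; apply/mnmP => k.
  have := disj k; rewrite -zv mnmDE mnmBE; have /mnm_lepP/(_ k) := wu; lia.
- move=> y ey; have [->//|yu] := eqVneq y u.
  have [->|yv] := eqVneq y v; first exact: term_order_refl.
  have [[_ _ letr] _ _] := le_term.
  by apply: (letr u) => //; apply: least; rewrite // ey.
Qed.

End Groebner.

Lemma universal_groebner_sub_graver :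
  sub_pm (universal_groebner_basis toric) (graver_basis toric).
Proof.
move=> g [le [G [le_term GG gG]]]; left.
exact: (reduced_groebner_basis_graver le_term GG).
Qed.

Lemma primitive_sym u v : primitive_pair toric u v -> primitive_pair toric v u.
Proof.
case=> uv /toric_binomial e prim; split; first by rewrite eq_sym.
  exact/toric_binomial.
move=> v' u' v'u' /toric_binomial e' v'v u'u.
suff [-> ->] : (u', v') = (u, v) by [].
by apply: prim; rewrite // 1?eq_sym //; apply/toric_binomial.
Qed.

(** A common variable could be cancelled from both monomials, against primitivity. *)
Lemma primitive_disjoint u v k : primitive_pair toric u v -> (u k == 0%N) || (v k == 0%N).
Proof.
case=> uv /toric_binomial e prim; apply/negPn; rewrite negb_or -!lep1mP.
apply/negP => /andP[ku kv].
have eqB (w : 'X_{1..m}) : (U_(k) <= w)%MM -> (mexp w = mexp (w - U_(k)) + mexp U_(k))%MM.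
  by move=> kw; rewrite -mexpD submK.
have [uE _] : (u - U_(k), v - U_(k))%MM = (u, v).
  apply: prim; rewrite ?lem_subr //.
    by apply/eqP => e'; case/eqP: uv; rewrite -(submK ku) e' submK.
  by apply/toric_binomial/(@addIm _ (mexp U_(k))); rewrite -!eqB.
have /mnmP/(_ k) := uE; rewrite mnmBE mnm1E eqxx.
by move: ku; rewrite lep1mP; lia.
Qed.

(* y <= u + v splits u - y into a part dividing u and a part dividing v. *)
Lemma primitive_conformal u v y : primitive_pair toric u v -> mexp y = mexp u ->
  (forall k, y k <= maxn (u k) (v k))%N -> y = u \/ y = v.
Proof.
move=> prim ey yle; have disj k := primitive_disjoint k prim.
case: prim => uv /toric_binomial e prim.
have [->|yu] := eqVneq y u; [by left | right].
pose d : 'X_{1..m} := [multinom minn (u k) (y k) | k < m].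
have du : (d <= u)%MM by apply/mnm_lepP => k; rewrite mnmE; lia.
have dy : (d <= y)%MM by apply/mnm_lepP => k; rewrite mnmE; lia.
have [uE vE] : (u - d, y - d)%MM = (u, v).
  apply: prim; rewrite ?lem_subr //.
  - by apply: contra yu => /eqP e'; rewrite -(submK dy) -e' submK.
  - by apply/toric_binomial/(@addIm _ (mexp d)); rewrite -!mexpD !submK.
  by apply/mnm_lepP => k; rewrite mnmBE mnmE; have := yle k; have := disj k; lia.
rewrite -vE; apply/mnmP => k; have /mnmP/(_ k) := uE.
by rewrite !mnmBE mnmE; lia.
Qed.

(** * Separating weights *)

(** Makes [u] and [v] the two least monomials of their fiber for [weighted_order W]; the tie-break
    decides which of them leads. *)
Definition separating_weight u v (W : 'I_m -> nat) : Prop :=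
  let d y := (\sum_k W k * y k)%N in
  d u = d v /\ forall y, mexp y = mexp u -> y != u -> y != v -> (d u < d y)%N.

Lemma separating_weight_groebner u v W : primitive_pair toric u v ->
  separating_weight u v W ->
  universal_groebner_basis toric ('X_[u] - 'X_[v]) \/
  universal_groebner_basis toric ('X_[v] - 'X_[u]).
Proof.
move=> prim; have disj k := primitive_disjoint k prim.
case: prim => uv /toric_binomial e _ /= [dE dlt].
have leT := term_order_weighted W; have [[letot _ _] _ _] := leT.
have /orP[leuv|levu] := letot u v; [right|left].
  apply: (universal_groebner_two_least leT) => //; first by rewrite eq_sym.
    by move=> k; rewrite orbC.
  by move=> y ey yv yu; rewrite /weighted_order -dE dlt // ey.
apply: (universal_groebner_two_least leT) => //.
by move=> y ey yu yv; rewrite /weighted_order dlt.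
Qed.

Lemma separating_weight_sym u v W : mexp u = mexp v ->
  separating_weight u v W -> separating_weight v u W.
Proof.
move=> e [dE dlt]; split=> // y ey yv yu.
by rewrite -dE; apply: dlt; rewrite // e.
Qed.

(** Only [e] and [e'] contribute to the degree in [x]. Comparing [y] with whichever of [u] and [v]
    vanishes at [e'], and dropping the term of [y] at [e'], bounds [y e]. *)
Lemma two_variable_bound u v y e e' x :
  mexp u = mexp v -> mexp y = mexp u -> (u e' == 0%N) || (v e' == 0%N) ->
  e' != e -> (0 < T e x)%N -> (forall k, k != e -> k != e' -> T k x = 0%N) ->
  (y e <= maxn (u e) (v e))%N.
Proof.
move=> euv ey disj e'e Tpos T0.
have two w : mexp w x = (T e x * w e + T e' x * w e')%N.
  rewrite mexpE (bigD1 e) //= (bigD1 e') //= big1 ?addn0 // => k /andP[ke ke'].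
  by rewrite T0.
have : mexp y x = mexp u x /\ mexp y x = mexp v x by rewrite ey -euv.
rewrite !two => -[yu yv]; case/orP: disj => /eqP z; rewrite z muln0 addn0 in yu yv.
  rewrite leq_max; apply/orP; left; rewrite -(leq_pmul2l Tpos) -yu; lia.
rewrite leq_max; apply/orP; right; rewrite -(leq_pmul2l Tpos) -yv; lia.
Qed.

Section OneFreeVariable.
Variable e0 : 'I_m.
Hypothesis T_neq0 : forall k, T k != 0%MM.
(** Abstract form of an edge [e] with an end [x] of degree two, [e'] being the other edge at [x]. *)
Hypothesis two_incident : forall e, e != e0 ->
  exists x e', [/\ e' != e, (0 < T e x)%N
                 & forall k, k != e -> k != e' -> T k x = 0%N].

Lemma fiber_bound u v y e : primitive_pair toric u v -> mexp y = mexp u ->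
  e != e0 -> (y e <= maxn (u e) (v e))%N.
Proof.
move=> prim ey /two_incident[x [e' [e'e Tpos T0]]].
have [_ /toric_binomial euv _] := prim.
exact: two_variable_bound euv ey (primitive_disjoint e' prim) e'e Tpos T0.
Qed.

(* Any other monomial y of the fiber exceeds both u and v at e0, by
   conformality, so u j * y e0 + (v e0 - u e0) * y j separates it from u and v;
   a multiple of the degree of the fiber makes this weight nonnegative. *)
Lemma exists_separating_weight_pos u v j : primitive_pair toric u v ->
  j != e0 -> (0 < u j)%N -> exists W, separating_weight u v W.
Proof.
move=> prim je0 uj.
(* The negative term at [j] is placed inside the degree term: [mdeg (T k)] is positive, so the
   subtraction never truncates. *)
pose W k := (u j * (k == e0) + v e0 * (k == j) +
  u e0 * (mdeg (T k) - (k == j)))%N.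
exists W.
have delta c i (y : 'X_{1..m}) : (\sum_k c * (k == i) * y k = c * y i)%N.
  rewrite (bigD1 i) //= eqxx muln1 big1 ?addn0 // => k /negbTE->.
  by rewrite muln0.
have WE (y : 'X_{1..m}) : (\sum_k W k * y k + u e0 * y j =
    u j * y e0 + v e0 * y j + u e0 * mdeg (mexp y))%N.
  rewrite mdeg_mexp big_distrr -!delta -!big_split; apply: eq_bigr => k _ /=.
  have : (0 < mdeg (T k))%N by rewrite lt0n mdeg_eq0.
  rewrite /W; case: (mdeg (T k)) => // t _; move: (y k) (nat_of_bool (k == e0)) => z b.
  by case: (k == j); rewrite ?subn0 ?subn1 /=; nia.
have disj k := primitive_disjoint k prim.
have [_ /toric_binomial euv _] := prim.
have := WE u; have := WE v; rewrite -euv => Wv Wu.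
have := disj j; have := disj e0 => de0 dj.
(* Since [u j] is positive, [v j] is zero; apart from the common degree term, both weights are
   [u j * v e0]. *)
split=> [|y ey yu yv]; first by nia.
have Wy := WE y; rewrite ey in Wy.
have ybig : (maxn (u e0) (v e0) < y e0)%N.
  rewrite ltnNge; apply/negP => yle.
  have [k||] := primitive_conformal prim ey; try by move/eqP; apply/negP.
  by have [->//|] := eqVneq k e0; apply: fiber_bound.
(* Here [y j <= u j], as [v j] is zero. The strict inequality follows from [ybig] in each of the
   cases [u e0 = 0] and [v e0 = 0]. *)
have := fiber_bound prim ey je0.
nia.
Qed.

Lemma primitive_separating_weight u v : primitive_pair toric u v ->
  exists W, separating_weight u v W.
Proof.
move=> prim; have [uv /toric_binomial euv _] := prim.
have [/existsP[j /andP[je0 ujv]]|/existsPn nj] :=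
  boolP [exists j, (j != e0) && (u j != v j)].
  have [uj|] := posnP (u j); last exact: exists_separating_weight_pos prim je0.
  have vj : (0 < v j)%N by move: ujv; rewrite uj; lia.
  have [W Wvu] := exists_separating_weight_pos (primitive_sym prim) je0 vj.
  by exists W; apply: separating_weight_sym Wvu.
(* If [u] and [v] agree outside [e0], the equal total degrees of their images force agreement at
   [e0] too. *)
case/eqP: uv; apply/mnmP => k.
have eqk i : i != e0 -> u i = v i by move=> ie0; have := nj i; rewrite ie0 negbK => /eqP.
have [->|/eqk//] := eqVneq k e0.
have := congr1 (@mdeg p) euv; rewrite !mdeg_mexp !(bigD1 (P := predT) e0) //=.
rewrite (eq_bigr (fun i => mdeg (T i) * v i)%N) => [|i /eqk->//].
by move=> /addIn /eqP; rewrite eqn_pmul2l ?lt0n ?mdeg_eq0 // => /eqP.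
Qed.

Lemma eq_universal_groebner_graver :
  eq_pm (universal_groebner_basis toric) (graver_basis toric).
Proof.
split=> [|_ [u [v [prim ->]]]]; first exact: universal_groebner_sub_graver.
rewrite opprB; have [W Wuv] := primitive_separating_weight prim.
exact: separating_weight_groebner prim Wuv.
Qed.

End OneFreeVariable.
End Toric.

(** * Cycles sharing a path *)

Lemma mem_zip_rot1 (X : eqType) (c : seq X) x y : uniq c ->
  ((x, y) \in zip c (rot 1 c)) = (x \in c) && (y == next c x).
Proof.
case: c => // x0 p Uc; rewrite rot1_cons.
have sz : size (x0 :: p) = size (rcons p x0) by rewrite size_rcons.
(* At the last vertex [next_nth] reads [p] past its end and returns the default [x0], which is the
   last entry of [rcons p x0]. *)
have nextE z : z \in x0 :: p ->
    next (x0 :: p) z = nth x0 (rcons p x0) (index z (x0 :: p)).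
  move=> zc; rewrite next_nth zc nth_rcons; case: ltngtP => // ltp.
    exact: nth_default (ltnW ltp).
  by rewrite ltp nth_default.
apply/(nthP (x0, x0))/andP => [[k]|[xc /eqP->]].
  rewrite size_zip -sz minnn nth_zip // => kp [<- <-].
  by rewrite mem_nth // nextE ?mem_nth // index_uniq.
exists (index x (x0 :: p)); first by rewrite size_zip -sz minnn index_mem.
by rewrite nth_zip // nth_index // nextE.
Qed.

Lemma mem_zip_behead (X : eqType) (x0 : X) (s : seq X) x y :
  reflect (exists2 k, (k.+1 < size s)%N & x = nth x0 s k /\ y = nth x0 s k.+1)
    ((x, y) \in zip s (behead s)).
Proof.
have szE : size (zip s (behead s)) = (size s).-1.
  by rewrite size_zip size_behead; lia.
apply: (iffP (nthP (x0, x0))) => [[k]|[k ks [-> ->]]].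
  rewrite nth_zip_cond szE => ks; rewrite ks nth_behead => -[<- <-].
  by exists k => //; lia.
have ks' : (k < (size s).-1)%N by lia.
by exists k; rewrite ?nth_zip_cond ?szE // ks' nth_behead.
Qed.

(** Rotate the cycle to [x, y, z, ...]; if [y] also preceded [x], its successor would be both [x]
    and [z]. *)
Lemma next_neq_prev (X : eqType) (c : seq X) x : (2 < size c)%N -> uniq c -> x \in c ->
  next c x != prev c x.
Proof.
move=> sz Uc xc; have [i p cE] := rot_to xc.
rewrite -(next_rot i Uc) -(prev_rot i Uc) cE.
have Up : uniq (x :: p) by rewrite -cE rot_uniq.
have : (2 < size (x :: p))%N by rewrite -cE size_rot.
case: p Up {cE} => // y [|z q] // Up _; apply/eqP => e.
have := next_prev Up x; rewrite -e /= !eqxx.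
move: Up; rewrite /= !inE !negb_or => /andP[/and3P[xy xz _] _].
by rewrite (eq_sym y) (negbTE xy) => zx; rewrite zx eqxx in xz.
Qed.

Section WeightedOrientedGraph.
Variable D : wograph.
Implicit Types (x y z t : vertex D) (a b : vertex D * vertex D) (c P : seq (vertex D)).

Definition links x y a := (a == (x, y)) || (a == (y, x)).

Lemma linksC x y a : links x y a = links y x a.
Proof. exact: orbC. Qed.

Lemma adjC x y : adj x y = adj y x.
Proof. exact: orbC. Qed.

Lemma adjP x y : reflect (exists2 a, a \in arcs D & links x y a) (adj x y).
Proof.
apply: (iffP orP) => [[xy|yx]|[a aD /orP[]/eqP e]].
- by exists (x, y); rewrite // /links eqxx.
- by exists (y, x); rewrite // /links eqxx orbT.
- by left; rewrite -e.
by right; rewrite -e.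
Qed.

Lemma links_unique x y a b : a \in arcs D -> b \in arcs D ->
  links x y a -> links x y b -> a = b.
Proof.
move=> aD bD /orP[]/eqP ea /orP[]/eqP eb; rewrite ea eb in aD bD *.
all: by rewrite // (negbTE (arcs_simple aD)) in bD.
Qed.

Lemma step_arcs_links s a : reflect
  (a \in arcs D /\ exists x y, (x, y) \in s /\ links x y a) (a \in step_arcs s).
Proof.
rewrite inE; apply: (iffP andP) => [[aD]|[aD [x [y [xys]]]]].
  case: a aD => i j aD /orP[] ijs; split=> //.
    by exists i, j; rewrite /links eqxx.
  by exists j, i; rewrite /links eqxx orbT.
by case/orP => /eqP e; split=> //; rewrite e /= xys ?orbT.
Qed.

Lemma cycle_arcs_links c x y a : uniq c -> a \in cycle_arcs c -> links x y a ->
  [/\ x \in c, y \in c & y = next c x \/ y = prev c x].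
Proof.
move=> Uc /step_arcs_links[aD [i [j [+ ija]]]].
rewrite mem_zip_rot1 // => /andP[ic /eqP jE] xya.
have [[-> ->]|[-> ->]] : (x = i /\ y = j) \/ (x = j /\ y = i).
  by case/orP: ija xya => /eqP-> /orP[]/eqP[-> ->]; auto.
by rewrite jE mem_next; split; auto.
by rewrite jE mem_next (prev_next Uc); split; auto.
Qed.

Definition degree_two x := exists y z,
  [/\ y != z, adj x y, adj x z & forall t, adj x t -> t = y \/ t = z].

(** As [y] is one of the two neighbours of [x], the second arc [a'] is the one to the other
    neighbour. *)
Lemma degree_two_arc x y a : degree_two x -> a \in arcs D -> links x y a ->
  exists a', [/\ a' \in arcs D, a' != a &
    forall b t, b \in arcs D -> links x t b -> b = a \/ b = a'].
Proof.
move=> [z [t [zt xz xt only]]] aD xya.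
have xy : adj x y by apply/adjP; exists a.
have other s : adj x s -> s != y -> (forall r, adj x r -> r = y \/ r = s) ->
  exists a', [/\ a' \in arcs D, a' != a &
    forall b t, b \in arcs D -> links x t b -> b = a \/ b = a'].
  move=> /adjP[a' a'D xsa'] sy onlys; exists a'; split=> //.
    apply: contra sy => /eqP e; move: xsa' xya; rewrite e.
    by case/orP => /eqP-> /orP[]/eqP[]; move=> *; subst; rewrite eqxx.
  move=> b r bD xrb; have [|er|er] := onlys r; first by apply/adjP; exists b.
    by left; apply: (links_unique (x := x) (y := r)) => //; rewrite er.
  by right; apply: (links_unique (x := x) (y := r)) => //; rewrite er.
have [ey|ey] := only y xy.
  by apply: (other t) => //; [rewrite ey eq_sym | rewrite ey].
by apply: (other z) => // [|r /only[->|->]]; rewrite ey //; auto.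
Qed.

Section SharedPath.
Variables (n : nat) (C : 'I_n -> seq (vertex D)) (P : seq (vertex D)).
Hypothesis CP : cycles_sharing_path C P.

Lemma adj_cycle x t : adj x t -> exists i,
  [/\ x \in C i, t \in C i & t = next (C i) x \/ t = prev (C i) x].
Proof.
have [[Ccyc _ _] _ _ _ DE] := CP.
case/adjP => a; rewrite DE => /bigcupP[i _ aC] xta; exists i.
by have /and3P[_ _ Uc] := Ccyc i; apply: cycle_arcs_links xta.
Qed.

(** Every edge at [x] belongs to some cycle through [x], hence to [C i]. *)
Lemma degree_two_single_cycle x i : x \in C i -> (forall j, x \in C j -> j = i) ->
  degree_two x.
Proof.
move=> xi single; have [[Ccyc _ _] _ _ _ _] := CP.
have /and3P[sz cyc Uc] := Ccyc i.
exists (next (C i) x), (prev (C i) x); split.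
- exact: next_neq_prev.
- exact: next_cycle.
- by rewrite adjC; apply: prev_cycle.
by move=> t /adj_cycle[j [/single-> _]].
Qed.

(** Every cycle contains both edges of [P] at an internal vertex, and these use up its two edges
    there. *)
Lemma degree_two_path_internal x0 k : (0 < k)%N -> (k.+1 < size P)%N ->
  degree_two (nth x0 P k).
Proof.
case: k => // k _ kP; have [[Ccyc /andP[sP UP] _] PC _ _ _] := CP.
set x := nth x0 P k.+1.
have step i : (i.+1 < size P)%N -> adj (nth x0 P i) (nth x0 P i.+1).
  by move=> iP; apply: (sortedP x0 sP).
exists (nth x0 P k), (nth x0 P k.+2).
have kx : adj x (nth x0 P k) by rewrite adjC; apply: step; apply: ltnW.
have xk : adj x (nth x0 P k.+2) by apply: step.
have kk : nth x0 P k != nth x0 P k.+2.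
  by rewrite nth_uniq ?(ltnW (ltnW kP)) // ; lia.
split=> // t /adj_cycle[i [_ _ ti]].
have /and3P[_ _ Uc] := Ccyc i.
have onC s : adj x s -> ((x, s) \in zip P (behead P)) || ((s, x) \in zip P (behead P)) ->
    s = next (C i) x \/ s = prev (C i) x.
  move=> /adjP[a aD xsa] sP'; have [_ /subsetP PCi _] := PC i.
  have /PCi aC : a \in path_arcs P.
    apply/step_arcs_links; split=> //; case/orP: sP' => sP'; first by exists x, s.
    by exists s, x; rewrite linksC.
  by have [] := cycle_arcs_links Uc aC xsa.
have yC : nth x0 P k = next (C i) x \/ nth x0 P k = prev (C i) x.
  apply: onC => //; apply/orP; right; apply/(mem_zip_behead x0).
  by exists k => //; apply: ltnW.
have zC : nth x0 P k.+2 = next (C i) x \/ nth x0 P k.+2 = prev (C i) x.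
  by apply: onC => //; apply/orP; left; apply/(mem_zip_behead x0); exists k.+1.
by case: yC zC => yE [] zE; move: kk; rewrite yE zE ?eqxx //; case: ti; auto.
Qed.

Hypothesis Cchordless : forall i, chordless (C i).

(** The exception [a0] is the first edge of [P]. A vertex off [P] lies on a single cycle, and any
    later edge of [P] starts at an internal vertex of [P]. *)
Lemma degree_two_endpoint : exists2 a0, a0 \in arcs D &
  forall a, a \in arcs D -> a != a0 -> exists x y, degree_two x /\ links x y a.
Proof.
have [[Ccyc /andP[sP UP] lenP] PC CC _ DE] := CP.
case PE : P lenP => [|x0 [|x1 s]] // _.
have /adjP[a0 a0D x01] : adj x0 x1 by move: sP; rewrite PE => /andP[].
exists a0 => // a aD aa0.
have [i _ aC] : exists2 i, true & a \in cycle_arcs (C i).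
  by move: aD; rewrite DE => /bigcupP[i _ aC]; exists i.
have /and3P[_ _ Uc] := Ccyc i.
case aE : a => [x y]; have xya : links x y a by rewrite /links aE eqxx.
rewrite -aE.
have [xi yi _] := cycle_arcs_links Uc aC xya.
have off z : z \in C i -> z \notin P -> degree_two z.
  move=> zi zP; apply: (degree_two_single_cycle zi) => j zj; apply/eqP.
  apply: contraR zP => ji; have [/(_ z)] := CC j i ji; by rewrite zi zj => <-.
have [xP|/(off x xi) x2] := boolP (x \in P); last by exists x, y.
have [yP|/(off y yi) y2] := boolP (y \in P); last by exists y, x; rewrite linksC.
have [aP|aP] := boolP (a \in path_arcs P).
  case/step_arcs_links: aP => _ [z [t [/(mem_zip_behead x0)[k kP [zE tE]] zta]]].
  case: k kP zE tE => [|k] kP zE tE.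
    case/eqP: aa0; apply: (links_unique (x := x0) (y := x1)) => //.
    by rewrite zE tE PE in zta.
  by exists z, t; rewrite zE in zta *; split=> //; apply: degree_two_path_internal.
(* An edge outside [P] joining two vertices of [P] would be a chord of any second cycle, so [C i] is
   the only cycle. *)
exists x, y; split=> //; apply: (degree_two_single_cycle xi) => j _.
apply/eqP/negPn/negP => ji; have [_ CCE] := CC j i ji; have [PCj _ _] := PC j.
have /negP[] := @Cchordless j a; rewrite /is_chord aD aE /= !PCj // !andbT.
by apply: contra aP => aCj; rewrite -CCE inE aE aCj -aE.
Qed.
End SharedPath.
End WeightedOrientedGraph.

(** * The toric ideal of the graph *)

Definition arc_exponent (D : wograph) (k : 'I_#|arcs D|) : 'X_{1..nvert D} :=
  (U_((enum_val k).1) + U_((enum_val k).2) *+ weight (enum_val k).2)%MM.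

Lemma toric_idealE (K : fieldType) (D : wograph) :
  @toric_ideal K D = @toric K _ _ (@arc_exponent D).
Proof.
rewrite /toric_ideal /toric; congr (fun t f => f \mPo t = 0).
by apply: eq_mktuple => k; rewrite /arc_exponent mpolyXD mpolyXn.
Qed.

Lemma arc_exponent_gt0 (D : wograph) (k : 'I_#|arcs D|) x :
  (0 < arc_exponent k x)%N = ((enum_val k).1 == x) || ((enum_val k).2 == x).
Proof.
rewrite /arc_exponent mnmDE mulmnE !mnm1E addn_gt0 muln_gt0 weight_gt0 andbT.
by case: eqP => _; case: eqP.
Qed.

Lemma eq_universal_groebner_graver_shared_path (K : fieldType) (D : wograph) (n : nat)
    (C : 'I_n -> seq (vertex D)) (P : seq (vertex D)) :
  cycles_sharing_path C P -> (forall i, chordless (C i)) ->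
  eq_pm (universal_groebner_basis (@toric_ideal K D)) (graver_basis (@toric_ideal K D)).
Proof.
move=> CP Cch; have [a0 a0D deg2] := degree_two_endpoint CP Cch.
have rankK a : a \in arcs D -> exists k : 'I_#|arcs D|, enum_val k = a.
  by move=> aD; exists (enum_rank_in a0D a); rewrite enum_rankK_in.
have [k0 k0E] := rankK a0 a0D.
have gt0_links (k : 'I_#|arcs D|) x : (0 < arc_exponent k x)%N ->
    exists t, links x t (enum_val k).
  rewrite arc_exponent_gt0 /links; case: (enum_val k) => i j /= /orP[]/eqP->.
    by exists j; rewrite eqxx.
  by exists i; rewrite eqxx orbT.
rewrite toric_idealE; apply: (eq_universal_groebner_graver K (e0 := k0)) => [k|e ek0].
  apply/eqP => k0'; have : (0 < arc_exponent k (enum_val k).1)%N.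
    by rewrite arc_exponent_gt0 eqxx.
  by rewrite k0' mnm0E.
have [|x [y [x2 xye]]] := deg2 (enum_val e) (enum_valP e).
  by rewrite -k0E (inj_eq enum_val_inj).
have [a' [a'D a'e only]] := degree_two_arc x2 (enum_valP e) xye.
have [e' e'E] := rankK a' a'D.
(* The coordinate of the vertex [x] occurs only in the exponents of the edges at [x], which are [e]
   and [e']. *)
exists x, e'; split=> [||k ke ke'].
- by rewrite -(inj_eq enum_val_inj) e'E.
- by rewrite arc_exponent_gt0; case/orP: xye => /eqP->; rewrite eqxx ?orbT.
apply/eqP; rewrite -leqn0 leqNgt; apply/negP => /gt0_links[t xtk].
have [/enum_val_inj|] := only _ t (enum_valP k) xtk; first by apply/eqP.
by rewrite -e'E => /enum_val_inj; apply/eqP.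
Qed.

Lemma eq_pm_sym (K : fieldType) (m : nat) (S T : {mpoly K[m]} -> Prop) :
  eq_pm S T -> eq_pm T S.
Proof. by case. Qed.

Lemma eq_pm_trans (K : fieldType) (m : nat) (S T U : {mpoly K[m]} -> Prop) :
  eq_pm S T -> eq_pm T U -> eq_pm S U.
Proof.
have sub (A B E : {mpoly K[m]} -> Prop) : sub_pm A B -> sub_pm B E -> sub_pm A E.
  move=> AB BE f /AB[/BE//|/BE]; rewrite opprK; tauto.
by move=> [ST TS] [TU UT]; split; [apply: sub ST TU | apply: sub UT TS].
Qed.

Theorem corollary3p8 (K : fieldType) (D : wograph) (n : nat)
    (C : 'I_n -> seq (vertex D)) (P : seq (vertex D)) :
  (0 < n)%N ->
  cycles_sharing_path C P ->
  (forall i, chordless (C i)) ->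
  (robust K D <-> strongly_robust K D) /\
  (generalized_robust K D <-> weakly_robust K D).
Proof.
move=> _ CP Cch; have UG := eq_universal_groebner_graver_shared_path K CP Cch.
have GU := eq_pm_sym UG; split; split.
- exact: minimal_generating_set_pm.
- exact: minimal_generating_set_pm.
- exact: eq_pm_trans.
- exact: eq_pm_trans.
Qed.
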